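(* Let $\mu$ be a probability measure on the unit circle $\mathbb{T}$ with infinite support, with orthonormal Szegő polynomials $\varphi_k$ and Schur parameters $\alpha_k$ ($k\ge 0$). Let $\{p_n\}_{n=0}^\infty$ be a generating sequence with $s_n=p_n-p_{n-1}$ ($n\ge1$), and let $\{\psi_n\}_{n=0}^{\infty}$ be the sequence of orthonormal Laurent polynomials for $\mu$ and $\{p_n\}$. Let $$\mathcal{S}=\big[\langle \psi_i(z), z\psi_j(z)\rangle\big]_{i,j=0}^{\infty}.$$ Define recursively $\mathcal{S}^{(0)}=G_{0,1}$ and, for $k\ge 1$, $$\mathcal{S}^{(k)}=\begin{cases}\mathcal{S}^{(k-1)}G_{k,k+1} & \text{if } s_k=0,\\ G_{k,k+1}\mathcal{S}^{(k-1)} & \text{if } s_k=1,\end{cases}$$ where $G_{k,k+1}$ is the Givens transformation built from $\alpha_k$. Then $\mathcal{S}$ admits the snake-shaped matrix factorization $\mathcal{S}=\mathcal{S}^{(\infty)}$, in the sense that for every $n\ge 1$ the principal $n\times n$ submatrices (rows and columns $0,\dots,n-1$) of $\mathcal{S}^{(n-1)}$ and of $\mathcal{S}$ coincide.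
   Context: Matrix rows and columns are indexed from $0$. Inner product: $\langle f,g\rangle=\int_{-\pi}^{\pi}\overline{f(e^{i\theta})}\,g(e^{i\theta})\,d\mu(\theta)$ (conjugate-linear in the first argument), where $\mu$ is a positive Borel measure on $\mathbb{T}$ of total mass $1$ with infinite support. Szegő polynomials: $\varphi_k$ is the orthonormal polynomial of degree $k$ with positive leading coefficient obtained by Gram-Schmidt from $1,z,z^2,\dots$. For a polynomial $p$ considered with order $k$, $p^*(z)=z^k\overline{p(1/\bar z)}$; $\varphi_k^*$ is taken with order $k$. The Schur parameters $\alpha_k\in\mathbb{C}$, $|\alpha_k|<1$, and complementary parameters $\rho_k=\sqrt{1-|\alpha_k|^2}\in(0,1]$ are determined by the Szegő recursion $$z\varphi_k(z)=\overline{\alpha_k}\,\varphi_k^*(z)+\rho_k\varphi_{k+1}(z),\qquad \varphi_{k+1}^*(z)=\rho_k\varphi_k^*(z)-\alpha_k\varphi_{k+1}(z),\qquad k\ge0.$$ Generating sequence: a sequence $\{p_n\}_{n\ge0}$ of non-negative integers with $p_0=0$, $0\le p_n\le n$ and $s_n:=p_n-p_{n-1}\in\{0,1\}$ for all $n\ge1$. Put $\mathcal{L}_n=\mathrm{span}\{z^j: -p_n\le j\le n-p_n\}$ and $\mathcal L_{-1}=\{0\}$. The sequence of orthonormal Laurent polynomials for $\mu$ and $\{p_n\}$ is the sequence with $\psi_0\equiv1$, $\psi_n\in\mathcal{L}_n\setminus\mathcal{L}_{n-1}$, $\langle\psi_n,\psi_m\rangle=\delta_{n,m}$, and such that $\psi_n$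 has a real positive coefficient at the power $z^{n-p_n}$ if $s_n=0$, respectively at $z^{-p_n}$ if $s_n=1$. Givens transformation: $G_{k,k+1}$ is the infinite matrix (indices $0,1,2,\dots$) equal to the identity except that its $2\times2$ block in rows and columns $\{k,k+1\}$ is $$\tilde G_{k,k+1}=\begin{bmatrix}\overline{\alpha_k}&\rho_k\\ \rho_k&-\alpha_k\end{bmatrix}.$$ *)

(* Defs.v *)
(* MathComp / MathComp-Analysis; complex numbers are R[i] for R : realType. *)
From HB Require Import structures.
From mathcomp Require Import all_boot all_order all_algebra.
From mathcomp Require Import finmap complex.
From mathcomp Require Import all_classical all_reals all_analysis.

Set Implicit Arguments.
Unset Strict Implicit.
Unset Printing Implicit Defensive.

Import Order.TTheory GRing.Theory Num.Theory.
Import numFieldNormedType.Exports.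

Local Open Scope classical_set_scope.
Local Open Scope ring_scope.

(* The alias R[i]^o is what carries the norm topology of R[i]. *)
Definition unit_circle (R : realType) : set R[i]^o := [set z | `|z| = 1].

Arguments unit_circle : clear implicits.

Definition circle (R : realType) : Type := set_type (unit_circle R).

HB.instance Definition _ (R : realType) := Topological.on (circle R).

Lemma unit_circle1 (R : realType) : (1 : R[i]^o) \in unit_circle R.
Proof. by apply/mem_set; rewrite /unit_circle /= normr1. Qed.

(* Needed only because measurable types are required to be pointed. *)
HB.instance Definition _ (R : realType) :=
  isPointed.Build (circle R) (SigSub (@unit_circle1 R) : set_type _).

Definition circle_val (R : realType) (z : circle R) : R[i] := set_val z.

(* The Borel sets of the circle (subspace topology); integrating a function of
   z in the circle against mu is \int_{-pi}^{pi} f(e^{i theta}) dmu(theta). *)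
Definition borel_circle (R : realType) :=
  g_sigma_algebraType (@open (circle R)).

Definition msupport (R : realType) (mu : probability (borel_circle R) R) :
    set (circle R) :=
  [set z | forall U : set (circle R), open U -> U z -> (0 < mu U)%E].

Definition cintegral (R : realType) (mu : probability (borel_circle R) R)
    (h : R[i] -> R[i]) : R[i] :=
  Complex (\int[mu]_z complex.Re (h (circle_val z)))
          (\int[mu]_z complex.Im (h (circle_val z))).

Definition inner (R : realType) (mu : probability (borel_circle R) R)
    (f g : R[i] -> R[i]) : R[i] :=
  cintegral mu (fun z => Num.conj (f z) * g z).

Definition orthonormal_szego (R : realType)
    (mu : probability (borel_circle R) R) (phi : nat -> {poly R[i]}) : Prop :=
  [/\ forall k, size (phi k) = k.+1,
      forall k, 0 < lead_coef (phi k)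
    & forall j k, inner mu (horner (phi j)) (horner (phi k)) = (j == k)%:R].

Definition star (R : realType) (k : nat) (p : {poly R[i]}) (z : R[i]) : R[i] :=
  z ^+ k * Num.conj p.[(Num.conj z)^-1].

Definition rho (R : realType) (alpha : nat -> R[i]) (k : nat) : R[i] :=
  sqrtC (1 - `|alpha k| ^+ 2).

(* The recursion is an identity between polynomials; it is asked for at z != 0
   because the formula for p^* has a removable singularity at 0. *)
Definition schur_parameters (R : realType) (phi : nat -> {poly R[i]})
    (alpha : nat -> R[i]) : Prop :=
  (forall k, `|alpha k| < 1) /\
  forall (k : nat) (z : R[i]), z != 0 ->
    z * (phi k).[z] = Num.conj (alpha k) * star k (phi k) z
                      + rho alpha k * (phi k.+1).[z] /\
    star k.+1 (phi k.+1) z = rho alpha k * star k (phi k) z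
                             - alpha k * (phi k.+1).[z].

Definition gen_step (p : nat -> nat) (n : nat) : int :=
  (p n)%:Z - (p n.-1)%:Z.

Definition generating_sequence (p : nat -> nat) : Prop :=
  [/\ p 0%N = 0%N,
      forall n, (p n <= n)%N
    & forall n, (1 <= n)%N -> gen_step p n = 0 \/ gen_step p n = 1].

(* A Laurent polynomial is given by its finitely supported coefficients. *)
Definition laurent (R : realType) := {fsfun int -> R[i] with 0}.

Definition leval (R : realType) (f : laurent R) (z : R[i]) : R[i] :=
  \sum_(j <- finsupp f) f j * z ^ j.

Definition laurent_space (R : realType) (p : nat -> nat) (n : nat) :
    set (laurent R) :=
  [set f | forall j : int,
     f j != 0 -> - (p n)%:Z <= j <= n%:Z - (p n)%:Z].

(* L_{n-1}, with L_{-1} = {0} *)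
Definition laurent_space_pred (R : realType) (p : nat -> nat) (n : nat) :
    set (laurent R) :=
  if n is m.+1 then laurent_space p m else [set f | forall j : int, f j = 0].

Definition orthonormal_laurent (R : realType)
    (mu : probability (borel_circle R) R) (p : nat -> nat)
    (psi : nat -> laurent R) : Prop :=
  [/\ forall j : int, psi 0%N j = (j == 0)%:R,
      forall n, (laurent_space p n `\` laurent_space_pred p n) (psi n),
      forall n m, inner mu (leval (psi n)) (leval (psi m)) = (n == m)%:R
    & forall n, (1 <= n)%N ->
        (gen_step p n = 0 -> 0 < psi n (n%:Z - (p n)%:Z)) /\
        (gen_step p n = 1 -> 0 < psi n (- (p n)%:Z))].

Definition infmx (R : realType) := nat -> nat -> R[i].

(* The sum ranges over the finite support of its summand; in the snake products
   below one factor is a Givens matrix, so this support is always finite. *)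
Definition infmul (R : realType) (A B : infmx R) : infmx R :=
  fun i j => \sum_(l \in [set: nat]) A i l * B l j.

Definition givens (R : realType) (alpha : nat -> R[i]) (k : nat) : infmx R :=
  fun i j =>
    if (i == k) && (j == k) then Num.conj (alpha k)
    else if (i == k) && (j == k.+1) then rho alpha k
    else if (i == k.+1) && (j == k) then rho alpha k
    else if (i == k.+1) && (j == k.+1) then - alpha k
    else (i == j)%:R.

Fixpoint snake (R : realType) (p : nat -> nat) (alpha : nat -> R[i])
    (k : nat) : infmx R :=
  match k with
  | 0 => givens alpha 0
  | k'.+1 => if gen_step p k'.+1 == 0
             then infmul (snake p alpha k') (givens alpha k'.+1)
             else infmul (givens alpha k'.+1) (snake p alpha k')
  end.

Definition laurent_matrix (R : realType) (mu : probability (borel_circle R) R)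
    (psi : nat -> laurent R) : infmx R :=
  fun i j => inner mu (leval (psi i)) (fun z => z * leval (psi j) z).

Definition principal_submx (R : realType) (n : nat) (A : infmx R) : 'M[R[i]]_n :=
  \matrix_(i < n, j < n) A i j.

(* Main.v *)
(* Write phi_k^* for star k (phi k).  By uniqueness of the orthonormal family,
   psi_n = z^(-p_n) phi_n if s_n = 0 and psi_n = z^(-p_n) phi_n^* if s_n = 1.
   The Szego recursion reads
     [z phi_k, phi_{k+1}^*] = [phi_k^*, phi_{k+1}] G_{k,k+1},
   and multiplying by G_{k,k+1} on the right (s_k = 0) or on the left (s_k = 1)
   propagates, by induction on k, the identity of row vectors
     [z psi_0, ..., z psi_k, z^(-p_k) phi_{k+1}^*]
       = [psi_0, ..., psi_k, z^(-p_k) phi_{k+1}] S^(k).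
   Taking inner products with psi_i, i <= k, gives the entries of S^(k), since
   z^(-p_k) phi_{k+1} is orthogonal to psi_0, ..., psi_k. *)
Require Import Defs.
From mathcomp Require Import all_boot all_order all_algebra finmap.
From mathcomp Require Import complex.
From mathcomp Require Import all_classical all_reals all_analysis.
From mathcomp Require Import measurable_realfun.
From mathcomp Require Import ring zify.

Set Implicit Arguments.
Unset Strict Implicit.
Unset Printing Implicit Defensive.

Import Order.TTheory GRing.Theory Num.Theory.
Import numFieldNormedType.Exports.

Local Open Scope classical_set_scope.
Local Open Scope ring_scope.

(** * The inner product on functions that are bounded and measurable on the circle *)

Section BoundedMeasurable.
Context (d : measure_display) (T : measurableType d) (R : realType).
Implicit Types f g : T -> R.

(** Boundedness is required, rather than integrability alone, so that the class is closed under
    products; a probability measure makes every member integrable. *)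
Definition bounded_measurable f :=
  measurable_fun setT f /\ exists M : R, forall x, `|f x| <= M.

Lemma bounded_measurable_cst (c : R) : bounded_measurable (fun=> c).
Proof. by split; [exact: measurable_cst | exists `|c|]. Qed.

Lemma bounded_measurableD f g : bounded_measurable f -> bounded_measurable g ->
  bounded_measurable (fun x => f x + g x).
Proof.
move=> [mf [M fM]] [mg [N gN]]; split; first exact: measurable_funD.
by exists (M + N) => x; rewrite (le_trans (ler_normD _ _))// lerD.
Qed.

Lemma bounded_measurableM f g : bounded_measurable f -> bounded_measurable g ->
  bounded_measurable (fun x => f x * g x).
Proof.
move=> [mf [M fM]] [mg [N gN]]; split; first exact: measurable_funM.
by exists (M * N) => x; rewrite normrM ler_pM.
Qed.

Lemma bounded_measurableN f : bounded_measurable f ->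
  bounded_measurable (fun x => - f x).
Proof.
move=> bf; under eq_fun do rewrite -mulN1r.
exact: bounded_measurableM (bounded_measurable_cst _) bf.
Qed.

Lemma bounded_measurableB f g : bounded_measurable f -> bounded_measurable g ->
  bounded_measurable (fun x => f x - g x).
Proof. by move=> bf bg; exact: bounded_measurableD bf (bounded_measurableN bg). Qed.

Lemma bounded_measurable_integrable (mu : probability T R) f :
  bounded_measurable f -> mu.-integrable setT (EFin \o f).
Proof.
move=> [mf [M fM]]; apply: measurable_bounded_integrable => //.
  by apply: (@le_lt_trans _ _ 1%E); [exact: probability_le1 | exact: ltry].
exists M; split; first by rewrite num_real.
by move=> N MN x _; apply: le_trans (fM x) _; exact: ltW.
Qed.

End BoundedMeasurable.

(** * Sesquilinearity of the inner product on the circle *)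

Section Inner.
Context (R : realType).
Implicit Types (mu : probability (borel_circle R) R) (f g h : R[i] -> R[i]).

Lemma continuous_circle_val : continuous (@circle_val R : circle R -> R[i]^o).
Proof. exact: (@initial_continuous (circle R) R[i]^o set_val). Qed.

(** A 1-Lipschitz function is continuous, so preimages of open rays are open in the circle and hence
    Borel. This serves for the real and imaginary parts. *)
Lemma measurable_circle_lipschitz (u : R[i] -> R) :
  (forall x y, `|u x - u y|%:C%C <= `|x - y|) ->
  measurable_fun setT (u \o @circle_val R : borel_circle R -> R).
Proof.
move=> uL; have cu : continuous (u : R[i]^o -> R).
  move=> x A /nbhs_ballP[e /= e0 eA].
  apply/(@nbhs_ballP R[i] R[i]^o); exists e%:C%C => /=; first by rewrite ltcR.
  move=> y xy; apply: eA; rewrite /ball/= -ltcR.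
  exact: le_lt_trans (uL _ _) xy.
apply: (measurability _ (RGenOInfty.measurableE R)) => //.
move=> _ [_ [a ->] <-]; rewrite setTI.
apply: sub_sigma_algebra.
apply: (@open_comp (circle R) R (u \o @circle_val R) `]a, +oo[%classic).
  move=> x _; apply: continuous_comp; first exact: continuous_circle_val.
  exact: cu.
by rewrite set_itvoy; exact: open_gt.
Qed.

(** The regularity under which [inner] is handled linearly. Only values on the circle count, so
    negative powers of z qualify despite the pole at 0. *)
Definition tame f :=
  bounded_measurable (fun z : borel_circle R => complex.Re (f (circle_val z))) /\
  bounded_measurable (fun z : borel_circle R => complex.Im (f (circle_val z))).

Lemma norm_circle_val (z : circle R) : `|circle_val z| = 1.
Proof. by have /set_mem := @valP _ _ (set_type (unit_circle R)) z. Qed.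

Lemma eq_tame f g : (forall z, `|z| = 1 -> f z = g z) -> tame f -> tame g.
Proof.
move=> fg [rf jf]; split.
- by under eq_fun do rewrite -fg ?norm_circle_val//.
- by under eq_fun do rewrite -fg ?norm_circle_val//.
Qed.

Lemma tame_cst (c : R[i]) : tame (fun=> c).
Proof. by split; exact: bounded_measurable_cst. Qed.

Lemma tameD f g : tame f -> tame g -> tame (fun z => f z + g z).
Proof.
move=> [rf jf] [rg jg]; split.
- under eq_fun do rewrite raddfD/=; exact: bounded_measurableD.
- under eq_fun do rewrite raddfD/=; exact: bounded_measurableD.
Qed.

Lemma ReM (x y : R[i]) : complex.Re (x * y) =
  complex.Re x * complex.Re y - complex.Im x * complex.Im y.
Proof. by case: x y => [a b] [c d]. Qed.

Lemma ImM (x y : R[i]) : complex.Im (x * y) =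
  complex.Re x * complex.Im y + complex.Im x * complex.Re y.
Proof. by case: x y => [a b] [c d]. Qed.

Lemma tameM f g : tame f -> tame g -> tame (fun z => f z * g z).
Proof.
move=> [rf jf] [rg jg]; split.
- under eq_fun do rewrite ReM.
  by apply: bounded_measurableB; exact: bounded_measurableM.
- under eq_fun do rewrite ImM.
  by apply: bounded_measurableD; exact: bounded_measurableM.
Qed.

Lemma conjE (x : R[i]) : Num.conj x = Complex (complex.Re x) (- complex.Im x).
Proof. by case: x. Qed.

Lemma tame_conj f : tame f -> tame (fun z => Num.conj (f z)).
Proof.
move=> [rf jf]; split; under eq_fun do rewrite conjE/=; first by [].
exact: bounded_measurableN.
Qed.

(** Multiplication by i preserves the modulus and turns the imaginary part, up to sign, into the
    real part. *)
Lemma normc_ge_Im (x : R[i]) : `|complex.Im x|%:C%C <= `|x|.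
Proof.
have -> : `|x| = `|x * 'i%C| by rewrite normrM [X in _ * X]normCi mulr1.
by apply: le_trans (normc_ge_Re _); rewrite ReiNIm normrN.
Qed.

Lemma tame_id : tame id.
Proof.
split; split.
- apply: (@measurable_circle_lipschitz (@complex.Re R)) => x y.
  by rewrite -raddfB normc_ge_Re.
- exists 1 => z; rewrite -lecR (le_trans (normc_ge_Re _))//.
  by rewrite norm_circle_val.
- apply: (@measurable_circle_lipschitz (@complex.Im R)) => x y.
  by rewrite -raddfB normc_ge_Im.
- exists 1 => z; rewrite -lecR (le_trans (normc_ge_Im _))//.
  by rewrite norm_circle_val.
Qed.

Lemma tame_sum n (F : nat -> R[i] -> R[i]) :
  (forall i, (i < n)%N -> tame (F i)) -> tame (fun z => \sum_(i < n) F i z).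
Proof.
elim: n => [|n IH] tF.
  by under eq_fun do rewrite big_ord0; exact: tame_cst.
under eq_fun do rewrite big_ord_recr/=.
by apply: tameD; [apply: IH => i /ltnW/tF | exact: tF].
Qed.

Lemma tameX n : tame (fun z => z ^+ n).
Proof.
elim: n => [|n IH]; first by under eq_fun do rewrite expr0; exact: tame_cst.
by under eq_fun do rewrite exprS; exact: tameM tame_id IH.
Qed.

Lemma tame_horner (q : {poly R[i]}) : tame (horner q).
Proof.
have -> : horner q = fun z => \sum_(i < size q) q`_i * z ^+ i.
  by apply/funext => z; rewrite horner_coef.
apply: (@tame_sum _ (fun i z => q`_i * z ^+ i)) => i _.
exact: tameM (tame_cst _) (tameX _).
Qed.

Lemma conj_circle (z : R[i]) : `|z| = 1 -> Num.conj z = z^-1.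
Proof. by move=> z1; rewrite invC_norm z1 expr1n invr1 mul1r. Qed.

Lemma tame_expz (j : int) : tame (fun z => z ^ j).
Proof.
case: j => n; first exact: tameX.
(* On the circle a negative power is the conjugate of a positive one. *)
apply: (@eq_tame (fun z => Num.conj (z ^+ n.+1))); last exact: tame_conj (tameX _).
by move=> z z1; rewrite rmorphXn/= conj_circle// exprVn.
Qed.

Lemma cintegralD mu f g : tame f -> tame g ->
  cintegral mu (fun z => f z + g z) = cintegral mu f + cintegral mu g.
Proof.
move=> [rf jf] [rg jg]; rewrite /cintegral.
under eq_Rintegral do rewrite raddfD/=.
under [X in Complex _ X]eq_Rintegral do rewrite raddfD/=.
by rewrite !RintegralD//; exact: bounded_measurable_integrable.
Qed.

Lemma cintegralZ mu c f : tame f ->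
  cintegral mu (fun z => c * f z) = c * cintegral mu f.
Proof.
move=> [rf jf]; rewrite /cintegral.
under eq_Rintegral do rewrite ReM.
under [X in Complex _ X]eq_Rintegral do rewrite ImM.
have irf := bounded_measurable_integrable mu rf.
have ijf := bounded_measurable_integrable mu jf.
have iZ (a : R) (h : borel_circle R -> R) : bounded_measurable h ->
    mu.-integrable setT (EFin \o (fun z : borel_circle R => a * h z)).
  move=> bh; apply: bounded_measurable_integrable.
  exact: (bounded_measurableM (f := fun=> a) (bounded_measurable_cst _ _) bh).
rewrite RintegralB ?RintegralD//; try exact: iZ.
by rewrite !RintegralZl//; case: c.
Qed.

Lemma eq_inner mu f f' g g' : (forall z, `|z| = 1 -> f z = f' z) ->
  (forall z, `|z| = 1 -> g z = g' z) -> inner mu f g = inner mu f' g'.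
Proof.
move=> ff gg; rewrite /inner /cintegral.
by congr Complex; apply: eq_Rintegral => z _; rewrite ff ?gg ?norm_circle_val.
Qed.

(** Unlike [eq_inner], this allows factors to migrate between the two arguments, as happens when
    polynomials are reversed. *)
Lemma eq_inner_integrand mu (u v f g : R[i] -> R[i]) :
  (forall z, `|z| = 1 -> Num.conj (u z) * v z = Num.conj (f z) * g z) ->
  inner mu u v = inner mu f g.
Proof.
move=> e; rewrite /inner /cintegral.
by congr Complex; apply: eq_Rintegral => z _; rewrite e ?norm_circle_val.
Qed.

Lemma innerZr mu c f g : tame f -> tame g ->
  inner mu f (fun z => c * g z) = c * inner mu f g.
Proof.
move=> tf tg; rewrite /inner -cintegralZ; last exact: tameM (tame_conj tf) tg.
by congr cintegral; apply/funext => z; rewrite mulrCA.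
Qed.

Lemma innerDr mu f g h : tame f -> tame g -> tame h ->
  inner mu f (fun z => g z + h z) = inner mu f g + inner mu f h.
Proof.
move=> tf tg th; rewrite /inner -cintegralD.
- by congr cintegral; apply/funext => z; rewrite mulrDr.
- exact: tameM (tame_conj tf) tg.
- exact: tameM (tame_conj tf) th.
Qed.

Lemma innerC mu f g : tame f -> tame g ->
  inner mu f g = Num.conj (inner mu g f).
Proof.
move=> tf tg; have [rh jh] := tameM (tame_conj tg) tf.
rewrite /inner /cintegral conjE/= -[X in _ = Complex _ X]mulN1r -RintegralZl//;
  last exact: bounded_measurable_integrable.
congr Complex; apply: eq_Rintegral => z _; rewrite !conjE.
- by rewrite !ReM/=; ring.
- by rewrite !ImM/= mulN1r; ring.
Qed.

Lemma inner_sumr mu n f (F : nat -> R[i] -> R[i]) (c : nat -> R[i]) :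
  tame f -> (forall i, (i < n)%N -> tame (F i)) ->
  inner mu f (fun z => \sum_(i < n) c i * F i z) =
  \sum_(i < n) c i * inner mu f (F i).
Proof.
move=> tf; elim: n => [|n IH] tF.
  (* The zero function is treated as 0 times [f], so that homogeneity covers the empty sum. *)
  rewrite big_ord0 -[RHS](mul0r (inner mu f f)) -innerZr//.
  by apply: eq_inner => // z _; rewrite big_ord0 mul0r.
rewrite big_ord_recr/= -IH; last by move=> i /ltnW/tF.
have tFn := tF n (leqnn _); have tFl i : (i < n)%N -> tame (F i) by move=> /ltnW/tF.
rewrite -innerZr// -innerDr//; last exact: tameM (tame_cst _) _.
  by apply: eq_inner => // z _; rewrite big_ord_recr.
apply: (@tame_sum n (fun i z => c i * F i z)) => i /tFl.
by apply: tameM; exact: tame_cst.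
Qed.

End Inner.

(** * Szego polynomials *)

Section Star.
Context (R : realType).
Implicit Types (q : {poly R[i]}) (z : R[i]).

(** Reversal as a genuine polynomial, so that size and coefficients are available; [star] is only a
    function. *)
Definition star_poly k q : {poly R[i]} := \poly_(i < k.+1) Num.conj q`_(k - i).

Lemma horner_star_poly k q z : (size q <= k.+1)%N -> z != 0 ->
  (star_poly k q).[z] = star k q z.
Proof.
move=> qk z0; rewrite /star horner_poly (horner_coef_wide _ qk) rmorph_sum mulr_sumr.
rewrite (reindex_inj rev_ord_inj)/=; apply: eq_bigr => i _.
have ik : (i <= k)%N by rewrite -ltnS.
rewrite subSS subKn// rmorphM rmorphXn fmorphV/= conjCK.
by rewrite mulrCA exprVn -expfB_cond// (negbTE z0).
Qed.

Lemma star_circle k q z : `|z| = 1 -> star k q z = z ^+ k * Num.conj q.[z].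
Proof. by move=> z1; rewrite /star (conj_circle z1) invrK. Qed.

(** A nonzero difference would have as roots all of 1, 2, ..., up to its size: these are nonzero,
    distinct in characteristic 0, and one more than its degree. *)
Lemma polyP_neq0 q q' : (forall z, z != 0 -> q.[z] = q'.[z]) -> q = q'.
Proof.
move=> qq; apply/eqP; rewrite -subr_eq0; apply/negPn/negP => r0.
pose s : seq R[i] := [seq i.+1%:R | i <- iota 0 (size (q - q'))].
have : (size s < size (q - q')%R)%N.
  apply: max_poly_roots => //.
    apply/allP => _ /mapP[i _ ->].
    by rewrite rootE hornerD hornerN qq ?subrr// pnatr_eq0.
  rewrite map_inj_uniq ?iota_uniq// => i j /eqP.
  by rewrite eqr_nat => /eqP[].
by rewrite size_map size_iota ltnn.
Qed.

(** Multiplication by z^j is an isometry because |z| = 1 on the circle. *)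
Lemma inner_shift (mu : probability (borel_circle R) R) (j : int) (f g : R[i] -> R[i]) :
  inner mu (fun z => z ^ j * f z) (fun z => z ^ j * g z) = inner mu f g.
Proof.
apply: eq_inner_integrand => z z1; rewrite rmorphM/= mulrACA.
suff -> : Num.conj (z ^ j) * z ^ j = 1 by rewrite mul1r.
by rewrite fmorphXz/= conj_circle// exprz_inv -expfzDr ?addNr// -normr_gt0 z1.
Qed.

End Star.

(** * Orthogonality of the Szegő polynomials and of their reversals *)

Section Szego.
Context (R : realType) (mu : probability (borel_circle R) R).
Implicit Types q : {poly R[i]}.
Context (phi : nat -> {poly R[i]}) (phi_szego : orthonormal_szego mu phi).

(** Since [phi n] has degree exactly n, a multiple of it cancels the coefficient of z^n, and
    induction handles the remainder. *)
Lemma szego_span n (q : {poly R[i]}) : (size q <= n)%N ->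
  exists c : nat -> R[i], q = \sum_(i < n) c i *: phi i.
Proof.
have [sphi _ _] := phi_szego.
elim: n q => [|n IH] q.
  by rewrite leqn0 size_poly_eq0 => /eqP ->; exists (fun=> 0); rewrite big_ord0.
move=> qn; have phin0 : (phi n)`_n != 0.
  by have := lead_coef_eq0 (phi n); rewrite lead_coefE -size_poly_eq0 sphi/= => ->.
pose a := q`_n / (phi n)`_n.
have /IH[c cE] : (size (q - a *: phi n)%R <= n)%N.
  apply/leq_sizeP => j; rewrite leq_eqVlt => /predU1P[<-|nj].
    by rewrite coefB coefZ divfK// subrr.
  rewrite coefB coefZ [q`_j]nth_default ?(leq_trans qn)//.
  by rewrite nth_default ?sphi// mulr0 subr0.
exists (fun i => if i == n then a else c i); rewrite big_ord_recr/= eqxx.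
rewrite -[LHS](subrK (a *: phi n)) cE; congr (_ + _).
by apply: eq_bigr => i _; rewrite ltn_eqF.
Qed.

Lemma szego_orth n q : (size q <= n)%N ->
  inner mu (horner (phi n)) (horner q) = 0.
Proof.
have [_ _ ophi] := phi_szego.
move=> /szego_span[c ->].
have -> : horner (\sum_(i < n) c i *: phi i) =
    fun z => \sum_(i < n) c i * (phi i).[z].
  by apply/funext => z; rewrite horner_sum; apply: eq_bigr => i _; rewrite hornerZ.
rewrite (@inner_sumr _ mu n _ (fun i => horner (phi i)) c);
  try by move=> *; exact: tame_horner.
by apply: big1 => i _; rewrite ophi gtn_eqF// mulr0.
Qed.

Lemma szego_orthl n q : (size q <= n)%N ->
  inner mu (horner q) (horner (phi n)) = 0.
Proof. by move=> qn; rewrite innerC ?szego_orth ?rmorph0//; exact: tame_horner. Qed.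

Lemma tame_star n : tame (star n (phi n)).
Proof.
apply: (@eq_tame _ (fun z => z ^+ n * Num.conj (phi n).[z])).
  by move=> z z1; rewrite star_circle.
exact: tameM (tameX _ _) (tame_conj (tame_horner _)).
Qed.

(** For n >= 1, reversing both arguments on the circle turns the pairing into that of [phi n] with
    the reversal of [q] of order n-1, whose degree is below n. *)
Lemma szego_star_orth n q : (size q <= n)%N ->
  inner mu (fun z => z * q.[z]) (star n (phi n)) = 0.
Proof.
(* For n = 0 there is no order n-1, but the size bound forces [q] to be zero. *)
case: n => [|n] qn.
  move: qn; rewrite leqn0 size_poly_eq0 => /eqP ->.
  have t0 := tame_star 0.
  rewrite -[RHS](mul0r (inner mu (star 0 (phi 0)) (star 0 (phi 0)))) -innerZr//.
  by apply: eq_inner_integrand => z _; rewrite horner0 mulr0 rmorph0 !mul0r mulr0.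
rewrite -(@szego_orth n.+1 (star_poly n q)); last exact: size_poly.
apply: eq_inner_integrand => z z1; have z0 : z != 0 by rewrite -normr_gt0 z1.
rewrite horner_star_poly// !star_circle// rmorphM/= conj_circle//.
by rewrite exprS; field.
Qed.

(** Reversal does not change the modulus on the circle. *)
Lemma szego_star_norm n :
  inner mu (star n (phi n)) (star n (phi n)) = 1.
Proof.
have [_ _ ophi] := phi_szego.
have <- : inner mu (horner (phi n)) (horner (phi n)) = 1 by rewrite ophi eqxx.
apply: eq_inner_integrand => z z1.
rewrite !star_circle// rmorphM/= conjCK mulrACA rmorphXn/= -exprMn conj_circle//.
by rewrite mulVf ?expr1n ?mul1r 1?mulrC// -normr_gt0 z1.
Qed.

End Szego.

(** * Orthonormal Laurent polynomials *)

Section Laurent.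
Context (R : realType).

Lemma expz_shift (a : nat) (z : R[i]) : z != 0 ->
  z ^ (- a.+1%:Z) * z = z ^ (- a%:Z).
Proof. by move=> z0; rewrite -[X in _ * X]expr1z -expfzDr//; congr (_ ^ _); lia. Qed.

(** This is z^a f whenever the exponents of [f] lie between -a and n-a; other coefficients are cut
    off. *)
Definition laurent_poly (a n : nat) (f : laurent R) : {poly R[i]} :=
  \poly_(i < n.+1) f (i%:Z - a%:Z).

Lemma leval_laurent_poly (a n : nat) (f : laurent R) (z : R[i]) :
  (forall j : int, f j != 0 -> - a%:Z <= j <= n%:Z - a%:Z) -> z != 0 ->
  leval f z = z ^ (- a%:Z) * (laurent_poly a n f).[z].
Proof.
move=> fan z0; rewrite /leval horner_poly mulr_sumr.
have -> : \sum_(i < n.+1) z ^ (- a%:Z) * (f (i%:Z - a%:Z) * z ^+ i) =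
    \sum_(j <- [seq i%:Z - a%:Z | i <- iota 0 n.+1]) f j * z ^ j.
  rewrite big_map -[iota 0 n.+1]/(index_iota 0 n.+1) big_mkord.
  apply: eq_bigr => i _; rewrite mulrCA; congr (_ * _).
  by rewrite exprnP -expfzDr// addrC.
set s := map _ _.
(* Exponents in the window but outside the support contribute 0; the remaining ones are a
   permutation of the support. *)
rewrite [RHS](bigID (fun j => j \in finsupp f))/= [X in _ + X]big1 ?addr0; last first.
  by move=> j; rewrite memNfinsupp => /eqP ->; rewrite mul0r.
rewrite -[RHS]big_filter; apply: perm_big; apply: uniq_perm.
- exact: fset_uniq.
- by rewrite filter_uniq// map_inj_uniq ?iota_uniq// => i j /addIr[].
move=> j; rewrite mem_filter; case: (boolP (j \in finsupp f)) => //= jf.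
have := jf; rewrite mem_finsupp /s => /fan /andP[aj jn].
apply/esym/mapP; exists (absz (j + a%:Z)).
  rewrite mem_iota; lia.
lia.
Qed.

End Laurent.

Section GeneratingSequence.
Context (p : nat -> nat) (p_gen : generating_sequence p).

Lemma gen_step0 n : gen_step p n.+1 = 0 -> p n.+1 = p n.
Proof. rewrite /gen_step/=; lia. Qed.

Lemma gen_step1 n : gen_step p n.+1 = 1 -> p n.+1 = (p n).+1.
Proof. rewrite /gen_step/=; lia. Qed.

Lemma gen_stepP n : gen_step p n.+1 = 0 \/ gen_step p n.+1 = 1.
Proof. by have [_ _] := p_gen; apply. Qed.

End GeneratingSequence.

(** * Identification of the Laurent polynomials with shifted Szegő polynomials *)

Section OrthonormalLaurent.
Context (R : realType) (mu : probability (borel_circle R) R).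
Context (p : nat -> nat) (p_gen : generating_sequence p).
Context (psi : nat -> laurent R) (psi_on : orthonormal_laurent mu p psi).

Let q n : {poly R[i]} := laurent_poly (p n) n (psi n).

Lemma psiE n z : z != 0 -> leval (psi n) z = z ^ (- (p n)%:Z) * (q n).[z].
Proof.
have [_ psiL _ _] := psi_on; have [psin _] := psiL n.
exact: leval_laurent_poly.
Qed.

Lemma tame_psi n : tame (leval (psi n)).
Proof.
apply: (@eq_tame _ (fun z => z ^ (- (p n)%:Z) * (q n).[z])).
  by move=> z z1; rewrite psiE// -normr_gt0 z1.
exact: tameM (tame_expz _ _) (tame_horner _).
Qed.

(* - p n + pivot n is the exponent of L_n that is not available in L_{n-1}. *)
Definition pivot n : nat := if gen_step p n == 0 then n else 0.

Lemma psi_pivot_gt0 n : 0 < (q n)`_(pivot n).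
Proof.
have [psi0 _ _ psi_gt0] := psi_on; have [p0 _ _] := p_gen.
rewrite /q /laurent_poly coef_poly /pivot; case: n => [|n].
  by rewrite if_same p0 subrr psi0 eqxx ltr01.
case: (gen_stepP p_gen n) => s; rewrite s/=.
  by rewrite ltnSn; apply: (psi_gt0 n.+1 _).1.
by rewrite sub0r; apply: (psi_gt0 n.+1 _).2.
Qed.

(** Elimination by induction: a multiple of the last Laurent polynomial cancels the pivot
    coefficient, and what is left belongs to the previous space. *)
Lemma psi_span n (r : {poly R[i]}) : (size r <= n.+1)%N ->
  exists c : nat -> R[i], forall z, z != 0 ->
    z ^ (- (p n)%:Z) * r.[z] = \sum_(m < n.+1) c m * leval (psi m) z.
Proof.
have qsz m : (size (q m) <= m.+1)%N by exact: size_poly.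
have qn0 m : (q m)`_(pivot m) != 0 by rewrite gt_eqF// psi_pivot_gt0.
elim: n r => [|n IH] r rn.
  exists (fun=> r`_0 / (q 0)`_0) => z z0; rewrite big_ord1 psiE//.
  have := qn0 0%N; rewrite /pivot if_same => q0.
  rewrite [in LHS](size1_polyC rn) [in X in _ = _ * (_ * X)](size1_polyC (qsz 0%N)).
  by rewrite !hornerC mulrCA divfK.
pose a := r`_(pivot n.+1) / (q n.+1)`_(pivot n.+1).
pose r1 := r - a *: q n.+1.
have r1sz : (size r1 <= n.+2)%N.
  by rewrite (leq_trans (size_polyD _ _))// geq_max rn size_polyN
    (leq_trans (size_scale_leq _ _)).
have r1e : r1`_(pivot n.+1) = 0 by rewrite coefB coefZ divfK// subrr.
suff [c cE] : exists c : nat -> R[i], forall z, z != 0 ->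
    z ^ (- (p n.+1)%:Z) * r1.[z] = \sum_(m < n.+1) c m * leval (psi m) z.
  exists (fun m => if m == n.+1 then a else c m) => z z0.
  have -> : r = r1 + a *: q n.+1 by rewrite subrK.
  rewrite big_ord_recr/= eqxx psiE// hornerD hornerZ mulrDr cE// mulrCA; congr (_ + _).
  by apply: eq_bigr => i _; rewrite ltn_eqF.
(* If the step is 0 the top coefficient of [r1] vanishes and the size drops; if it is 1 the constant
   term vanishes and a factor 'X comes out, absorbed by the change of shift. *)
case: (gen_stepP p_gen n) => s; move: r1e; rewrite /pivot s/= => r1e.
  rewrite (gen_step0 s); apply: IH; apply/leq_sizeP => j.
  rewrite leq_eqVlt => /predU1P[<-//|nj].
  by rewrite nth_default// (leq_trans r1sz).
have r1E : r1 = \poly_(i < n.+1) r1`_i.+1 * 'X.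
  apply/polyP => -[|j]; rewrite coefMX//= coef_poly; case: ltnP => // nj.
  by rewrite nth_default// (leq_trans r1sz).
have [c cE] := IH _ (size_poly n.+1 (fun i => r1`_i.+1)).
exists c => z z0; rewrite -cE// (gen_step1 s) [in LHS]r1E hornerMX.
by rewrite -[in RHS](expz_shift _ z0) -mulrA [z * _]mulrC.
Qed.

(** The spaces L_m increase: each step 1 lowers the smallest exponent, at the cost of one more
    factor 'X. *)
Lemma psi_widen m n : (m <= n)%N -> exists2 r : {poly R[i]}, (size r <= n.+1)%N &
  forall z, z != 0 -> leval (psi m) z = z ^ (- (p n)%:Z) * r.[z].
Proof.
elim: n => [|n IH].
  by rewrite leqn0 => /eqP ->; exists (q 0); [exact: size_poly | exact: psiE].
rewrite leq_eqVlt => /predU1P[->|].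
  by exists (q n.+1); [exact: size_poly | exact: psiE].
rewrite ltnS => /IH[r rn rE]; case: (gen_stepP p_gen n) => s.
  by exists r; [exact: leqW | rewrite (gen_step0 s)].
exists (r * 'X).
  by rewrite (leq_trans (size_polyMleq _ _))// size_polyX addn2.
move=> z z0; rewrite rE// (gen_step1 s) hornerMX.
by rewrite -[in LHS](expz_shift _ z0) -mulrA [z * _]mulrC.
Qed.

(** Uniqueness of the orthonormal family: orthogonality leaves F = c psi_n, the pivot coefficients
    give c > 0, and the norms give |c| = 1. *)
Lemma psi_eq n (P : {poly R[i]}) (F : R[i] -> R[i]) : (size P <= n.+1)%N ->
  (forall z, z != 0 -> F z = z ^ (- (p n)%:Z) * P.[z]) ->
  (forall m, (m < n)%N -> inner mu (leval (psi m)) F = 0) ->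
  inner mu F F = 1 -> 0 < P`_(pivot n) ->
  forall z, z != 0 -> leval (psi n) z = F z.
Proof.
have [_ _ opsi _] := psi_on.
move=> Pn FE Forth F1 Ppos; have [c cE] := psi_span Pn.
have c0 m : (m < n)%N -> c m = 0.
  move=> mn; rewrite -(Forth m mn).
  rewrite (@eq_inner _ mu _ (leval (psi m)) _
    (fun z => \sum_(m < n.+1) c m * leval (psi m) z))//; last first.
    by move=> z z1; rewrite -cE -?FE// -normr_gt0 z1.
  rewrite (@inner_sumr _ mu _ _ (fun m => leval (psi m)) c);
    [|exact: tame_psi|by move=> *; exact: tame_psi].
  rewrite (bigD1 (Ordinal (leqW mn)))//= opsi eqxx mulr1 big1 ?addr0// => i im.
  by rewrite opsi eq_sym [_ == m](negbTE im) mulr0.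
have {}FcE z : z != 0 -> F z = c n * leval (psi n) z.
  move=> z0; rewrite FE// cE// big_ord_recr/= big1 ?add0r// => i _.
  by rewrite c0 ?mul0r.
have PE : P = c n *: q n.
  apply: polyP_neq0 => z z0; rewrite hornerZ.
  apply: (@mulfI _ (z ^ (- (p n)%:Z))); first exact: expfz_neq0.
  by rewrite -FE// FcE// psiE// mulrCA.
have cpos : 0 < c n.
  by move: Ppos; rewrite PE coefZ pmulr_lgt0// psi_pivot_gt0.
suff c1 : c n = 1 by move=> z z0; rewrite FcE// c1 mul1r.
have : `|c n| ^+ 2 = 1.
  rewrite -F1 normCKC.
  have -> : inner mu F F = inner mu F (fun z => c n * leval (psi n) z).
    by apply: eq_inner => // z z1; rewrite FcE// -normr_gt0 z1.
  have tF : tame F.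
    apply: (@eq_tame _ (fun z => c n * leval (psi n) z)).
      by move=> z z1; rewrite FcE// -normr_gt0 z1.
    exact: tameM (tame_cst _) (tame_psi _).
  rewrite innerZr//; last exact: tame_psi.
  rewrite innerC//; last exact: tame_psi.
  have -> : inner mu (leval (psi n)) F =
      inner mu (leval (psi n)) (fun z => c n * leval (psi n) z).
    by apply: eq_inner => // z z1; rewrite FcE// -normr_gt0 z1.
  rewrite innerZr; try exact: tame_psi.
  by rewrite opsi eqxx mulr1 mulrC.
by move/eqP; rewrite sqrp_eq1 ?normr_ge0// gtr0_norm// => /eqP.
Qed.

Context (phi : nat -> {poly R[i]}) (phi_szego : orthonormal_szego mu phi).

Lemma tame_shift_phi (j : int) n : tame (fun z => z ^ j * (phi n).[z]).
Proof. exact: tameM (tame_expz _ _) (tame_horner _). Qed.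

(** After multiplication by z^(p_n), psi_m becomes a polynomial of degree at most n, orthogonal to
    [phi n.+1]. *)
Lemma psi_phi_orth m n : (m <= n)%N ->
  inner mu (leval (psi m)) (fun z => z ^ (- (p n)%:Z) * (phi n.+1).[z]) = 0.
Proof.
move=> /psi_widen[r rn rE]; rewrite -(szego_orthl phi_szego rn).
rewrite -[RHS](inner_shift mu (- (p n)%:Z)); apply: eq_inner => // z z1.
by rewrite rE// -normr_gt0 z1.
Qed.

(** The case n = 0 is included: the predecessor of 0 is 0, so [gen_step p 0] is 0. *)
Lemma psi_szego n z : gen_step p n = 0 -> z != 0 ->
  leval (psi n) z = z ^ (- (p n)%:Z) * (phi n).[z].
Proof.
have [sphi lphi ophi] := phi_szego; have [p0 _ _] := p_gen.
move=> s; apply: (@psi_eq n (phi n)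
  (fun z => z ^ (- (p n)%:Z) * (phi n).[z])) => //.
- by rewrite sphi.
- case: n s => // n s m mn; rewrite (gen_step0 s); exact: psi_phi_orth.
- by rewrite inner_shift ophi eqxx.
- by rewrite /pivot s eqxx; have := lphi n; rewrite lead_coefE sphi.
Qed.

Lemma psi_szego_star n z : gen_step p n = 1 -> z != 0 ->
  leval (psi n) z = z ^ (- (p n)%:Z) * star n (phi n) z.
Proof.
have [sphi lphi ophi] := phi_szego; have [p0 _ _] := p_gen.
move=> s; apply: (@psi_eq n (star_poly n (phi n))
  (fun z => z ^ (- (p n)%:Z) * star n (phi n) z)) => //.
- exact: size_poly.
- by move=> t t0; rewrite horner_star_poly// sphi.
(* The shift grows by one, so earlier Laurent polynomials take the form z^(-p_(n+1)) z r with r of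
   degree at most n, as [szego_star_orth] requires. *)
- case: n s => // n s m; rewrite ltnS => /psi_widen[r rn rE].
  rewrite -(szego_star_orth phi_szego rn) -[RHS](inner_shift mu (- (p n.+1)%:Z)).
  apply: eq_inner => // t t1; have t0 : t != 0 by rewrite -normr_gt0 t1.
  by rewrite rE// (gen_step1 s) mulrA expz_shift.
- by rewrite inner_shift szego_star_norm.
(* The pivot coefficient is the constant term of the reversal, namely the conjugate of the positive
   leading coefficient of [phi n]. *)
- have := lphi n; rewrite lead_coefE sphi/= => lpos.
  by rewrite /pivot s/= coef_poly/= subn0 conj_Creal// gtr0_real.
Qed.

Lemma phi0_eq1 : phi 0 = 1.
Proof.
have [sphi _ _] := phi_szego; have [p0 _ _] := p_gen; have [psi0 _ _ _] := psi_on.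
apply: polyP_neq0 => z z0; rewrite hornerC.
have := @psi_szego 0 z; rewrite /gen_step subrr => /(_ erefl z0).
rewrite p0 oppr0 expr0z mul1r => <-.
rewrite psiE// p0 oppr0 expr0z mul1r horner_poly big_ord1 expr0 mulr1.
by rewrite p0 subrr psi0 eqxx.
Qed.

End OrthonormalLaurent.

(** * Snake-shaped products of Givens matrices *)

Section Snake.
Context (R : realType).
Implicit Types A B : infmx R.

(** A finite block followed by the identity; such matrices have products given by finite sums. *)
Definition identity_beyond N A :=
  forall i j, (N <= maxn i j)%N -> A i j = (i == j)%:R.

Lemma infmulE N A B i j : identity_beyond N A -> (maxn i j < N)%N ->
  infmul A B i j = \sum_(l < N) A i l * B l j.
Proof.
rewrite gtn_max => AN /andP[iN jN]; rewrite /infmul (fsbigE (iota 0 N)).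
- rewrite -[in LHS](subn0 N) -[iota 0 _]/(index_iota 0 N) big_mkord; apply: eq_bigl => l.
  by rewrite in_setT.
- exact: iota_uniq.
- by [].
- move=> l _; rewrite mem_iota add0n/= -leqNgt => Nl.
  by rewrite AN ?leq_max ?Nl ?orbT// ltn_eqF ?mul0r// (leq_trans iN).
Qed.

Lemma identity_beyond_infmul N A B : identity_beyond N A -> identity_beyond N B ->
  identity_beyond N (infmul A B).
Proof.
move=> AN BN i j Nij; rewrite (@infmulE (maxn i j).+1)//; last first.
  by move=> k l kl; apply: AN; rewrite (leq_trans Nij)// ltnW.
case: (leqP N i) => Ni.
  have iM : (i < (maxn i j).+1)%N by rewrite ltnS leq_maxl.
  rewrite (bigD1 (Ordinal iM))//= big1 ?addr0 => [|l /negbTE li].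
    by rewrite AN ?leq_max ?Ni// eqxx mul1r BN.
  by rewrite AN ?leq_max ?Ni// eq_sym [_ == _]li mul0r.
have Nj : (N <= j)%N by move: Nij; rewrite leq_max leqNgt Ni.
have jM : (j < (maxn i j).+1)%N by rewrite ltnS leq_maxr.
rewrite (bigD1 (Ordinal jM))//= big1 ?addr0 => [|l /negbTE lj].
  by rewrite [B _ _]BN ?leq_max ?Nj// eqxx mulr1 AN.
by rewrite [B _ _]BN ?leq_max ?Nj ?orbT// [_ == _]lj mulr0.
Qed.

Variables (p : nat -> nat) (alpha : nat -> R[i]).

Lemma identity_beyond_givens k : identity_beyond k.+2 (givens alpha k).
Proof.
move=> i j; rewrite /givens leq_max => ij.
do 4 (case: ifP => [/andP[/eqP ei /eqP ej]|_]; first by move: ij; rewrite ei ej; lia).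
by [].
Qed.

Lemma identity_beyond_snake k : identity_beyond k.+2 (snake p alpha k).
Proof.
elim: k => [|k IH]; first exact: identity_beyond_givens.
have IH' : identity_beyond k.+3 (snake p alpha k).
  by move=> i j ij; apply: IH; rewrite ltnW.
by rewrite /=; case: ifP => _; apply: identity_beyond_infmul => //;
  exact: identity_beyond_givens.
Qed.

(** A row vector times a Givens matrix changes only in entries k and k+1. *)
Lemma sum_givens k (f : nat -> R[i]) j : (j < k.+2)%N ->
  \sum_(l < k.+2) f l * givens alpha k l j =
  if j == k then f k * Num.conj (alpha k) + f k.+1 * rho alpha k
  else if j == k.+1 then f k * rho alpha k - f k.+1 * alpha k
  else f j.
Proof.
move=> jk; rewrite !big_ord_recr/=; rewrite /givens !eqxx/=.
have kk : (k == k.+1) = false by rewrite ltn_eqF.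
have kk' : (k.+1 == k) = false by rewrite gtn_eqF.
have sumE : \sum_(i < k) f i * (val i == j)%:R = if (j < k)%N then f j else 0.
  case: ltnP => jk1.
    rewrite (bigD1 (Ordinal jk1))//= eqxx mulr1 big1 ?addr0// => i ij.
    by rewrite [_ == j](negbTE ij) mulr0.
  rewrite big1// => i _; rewrite ltn_eqF ?mulr0//.
  exact: leq_trans (ltn_ord i) jk1.
under eq_bigr => i _.
  rewrite (ltn_eqF (ltn_ord i)) (ltn_eqF (leqW (ltn_ord i)))/=; over.
rewrite {}sumE !kk !kk'/=; case: (ltngtP j k) => [jk1|jk1|_].
- by rewrite (ltn_eqF (leqW jk1)) (gtn_eqF (leqW jk1)) !mulr0 !addr0.
- have -> : j = k.+1 by apply/eqP; rewrite eqn_leq jk1 andbT.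
  by rewrite eqxx add0r mulrN.
- by rewrite add0r.
Qed.

End Snake.

(** * The snake-shaped factorization *)

Section Factorization.
Context (R : realType) (mu : probability (borel_circle R) R).
Context (phi : nat -> {poly R[i]}) (phi_szego : orthonormal_szego mu phi).
Context (alpha : nat -> R[i]) (alpha_schur : schur_parameters phi alpha).
Context (p : nat -> nat) (p_gen : generating_sequence p).
Context (psi : nat -> laurent R) (psi_on : orthonormal_laurent mu p psi).

(** Encodes the row [G_0, ..., G_k, z^(-p_k) F] of length k+2, with the tail at index k+1. *)
Definition row_tail k (F : R[i] -> R[i]) (G : nat -> R[i] -> R[i]) l (z : R[i]) :=
  if (l <= k)%N then G l z else z ^ (- (p k)%:Z) * F z.

Local Notation phis k := (fun z => star k (phi k) z).

Lemma snake_mul k j z : z != 0 -> (j < k.+2)%N ->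
  \sum_(i < k.+2)
    row_tail k (horner (phi k.+1)) (fun i => leval (psi i)) i z * snake p alpha k i j
  = row_tail k (phis k.+1) (fun i z => z * leval (psi i) z) j z.
Proof.
move=> z0; have [_ schur] := alpha_schur; have [p0 _ _] := p_gen.
have psi0 : leval (psi 0) z = 1.
  rewrite (psi_szego p_gen psi_on phi_szego)//; last by rewrite /gen_step subrr.
  by rewrite (phi0_eq1 p_gen psi_on phi_szego) p0 hornerC mulr1.
elim: k j => [|k IH] j jk.
  (* Base case: [1, phi_1] times G_{0,1} is the first Szegő recursion, as psi_0 and phi_0 are both
     1. *)
  rewrite (@sum_givens _ _ 0 (fun i => row_tail _ _ _ i z))// /row_tail/= psi0.
  have [e1 e2] := schur 0%N z z0.
  have phi0 := phi0_eq1 p_gen psi_on phi_szego.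
  have star0 : star 0 (phi 0) z = 1.
    by rewrite /star phi0 hornerC rmorph1 mulr1 expr0.
  move: e1 e2; rewrite star0 phi0 hornerC !mulr1 p0 oppr0 expr0z !mul1r => e1 e2.
  case: j jk => [|[|//]] _ /=; first by rewrite psi0 mulr1 [_ * rho _ _]mulrC -e1.
  by rewrite e2 mulrC.
have [e1 e2] := schur k.+1 z z0.
(* S^(k) fixes index k+2, so the new last entry of a row splits off. *)
have peel (B : nat -> R[i]) l : (l < k.+3)%N ->
    \sum_(i < k.+3) B i * snake p alpha k i l =
    if l == k.+2 then B k.+2 else \sum_(i < k.+2) B i * snake p alpha k i l.
  move=> lk; rewrite big_ord_recr/= (@identity_beyond_snake _ _ _ k k.+2) ?leq_maxl//.
  rewrite [k.+2 == l]eq_sym; have [->|lk2] := eqVneq l k.+2.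
    rewrite mulr1 big1 ?add0r// => i _.
    by rewrite identity_beyond_snake ?leq_maxr// ltn_eqF ?mulr0.
  by rewrite mulr0 addr0.
have idS : identity_beyond k.+3 (snake p alpha k).
  by move=> i l il; apply: identity_beyond_snake; rewrite ltnW.
have idG := @identity_beyond_givens R alpha k.+1.
rewrite [snake p alpha k.+1]/=.
case: (gen_stepP p_gen k) => s; rewrite s/=.
  (* Step 0: the shift is unchanged and the old tail is psi_{k+1}. So S^(k) acts first by induction,
     giving [C], and G_{k+1,k+2} then combines its last two entries. *)
  have pk := gen_step0 s.
  have psik := psi_szego p_gen psi_on phi_szego s z0; rewrite pk in psik.
  under eq_bigr => i _.
    rewrite (infmulE _ idS) ?gtn_max ?jk ?ltn_ord// mulr_sumr; over.
  rewrite exchange_big/=.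
  under eq_bigr => l _.
    under eq_bigr do rewrite mulrA.
    rewrite -mulr_suml (peel (fun i => row_tail k.+1
      (horner (phi k.+2)) (fun i0 => leval (psi i0)) i z))//; over.
  pose C l := if l == k.+2 then z ^ (- (p k)%:Z) * (phi k.+2).[z]
     else row_tail k (phis k.+1) (fun i z => z * leval (psi i) z) l z.
  transitivity (\sum_(l < k.+3) C l * givens alpha k.+1 l j).
    apply: eq_bigr => l _; congr (_ * _); rewrite /C.
    case: eqP => [_|/eqP lk]; first by rewrite /row_tail ltnn pk.
    have lk' : (l < k.+2)%N by rewrite ltn_neqAle lk -ltnS ltn_ord.
    rewrite -IH//; apply: eq_bigr => i _; congr (_ * _).
    rewrite /row_tail -ltnS ltn_ord; case: leqP => // ki.
    have -> : val i = k.+1 by apply/eqP; rewrite eqn_leq -ltnS ltn_ord.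
    by rewrite psik.
  rewrite sum_givens// /C /row_tail !eqxx ltnn.
  have -> : (k.+1 == k.+2) = false by rewrite ltn_eqF.
  case: eqP => [->|/eqP jk1].
    rewrite leqnn psik [z * _]mulrCA e1; ring.
  case: eqP => [->|/eqP jk2].
    rewrite ltnn pk e2; ring.
  have jk' : (j <= k)%N by move: jk jk1 jk2; lia.
  by rewrite jk' leqW.
(* Step 1: G_{k+1,k+2} acts first. In the resulting row [D] the entry k+1 is z^(-p_(k+1)) z
   phi_{k+1} = z^(-p_k) phi_{k+1}, the old tail, so the induction hypothesis applies to the first
   k+2 entries. *)
have pk := gen_step1 s.
have shift := expz_shift (p k) z0; rewrite -pk in shift.
have psik := psi_szego_star p_gen psi_on phi_szego s z0.
under eq_bigr => i _.
  rewrite (infmulE _ idG) ?gtn_max ?jk ?ltn_ord// mulr_sumr; over.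
rewrite exchange_big/=.
under eq_bigr => l _.
  under eq_bigr do rewrite mulrA.
  rewrite -mulr_suml (@sum_givens _ _ k.+1 (fun i => row_tail _ _ _ i z))//; over.
pose D l := if l == k.+2 then z ^ (- (p k.+1)%:Z) * star k.+2 (phi k.+2) z
   else row_tail k (horner (phi k.+1)) (fun i => leval (psi i)) l z.
transitivity (\sum_(l < k.+3) D l * snake p alpha k l j).
  apply: eq_bigr => l _; congr (_ * _); rewrite /D /row_tail leqnn ltnn.
  case: eqP => [->|/eqP lk1].
    have -> : (k.+1 == k.+2) = false by rewrite ltn_eqF.
    rewrite ltnn -shift -mulrA e1 psik; ring.
  case: eqP => [_|/eqP lk2].
    rewrite e2 psik; ring.
  have lk' : (l <= k)%N by move: (ltn_ord l) lk1 lk2; lia.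
  by rewrite lk' leqW.
rewrite peel//; case: eqP => [->|/eqP jk2].
  by rewrite /D eqxx /row_tail ltnn.
have jk' : (j < k.+2)%N by rewrite ltn_neqAle jk2 -ltnS.
transitivity (row_tail k (phis k.+1) (fun i z => z * leval (psi i) z) j z).
  rewrite -IH//; apply: eq_bigr => i _; congr (_ * _).
  by rewrite /D ltn_eqF.
rewrite /row_tail -[(j <= k.+1)%N]ltnS jk'; case: leqP => // kj.
(* The tail produced by the induction hypothesis is already z psi_{k+1}, again by the change of
   shift. *)
have -> : j = k.+1 by apply/eqP; rewrite eqn_leq -ltnS jk'.
by rewrite psik -shift; ring.
Qed.

(** The bound on [j] makes column j of [snake_mul] equal to z psi_j rather than the tail; the bound
    on [i] makes psi_i orthogonal to the tail on the other side. *)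
Lemma snake_laurent_matrix k i j : (i <= k)%N -> (j <= k)%N ->
  snake p alpha k i j = laurent_matrix mu psi i j.
Proof.
have [_ _ opsi _] := psi_on.
move=> ik jk; have jk2 : (j < k.+2)%N by rewrite ltnS leqW.
rewrite /laurent_matrix.
pose B l := row_tail k (horner (phi k.+1)) (fun i => leval (psi i)) l.
have tB l : tame (B l).
  rewrite /B /row_tail; case: leqP => _; first exact: tame_psi psi_on _.
  exact: tame_shift_phi.
have tpsi := tame_psi psi_on.
transitivity (inner mu (leval (psi i))
    (fun z => \sum_(l < k.+2) snake p alpha k l j * B l z)); last first.
  apply: eq_inner => // z z1; have z0 : z != 0 by rewrite -normr_gt0 z1.
  under eq_bigr do rewrite mulrC.
  by rewrite snake_mul// /row_tail jk.
rewrite [RHS](@inner_sumr _ mu _ _ B (fun l => snake p alpha k l j))//.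
rewrite big_ord_recr/= /B {2}/row_tail ltnn.
rewrite (psi_phi_orth p_gen psi_on phi_szego ik) mulr0 addr0.
have ik1 : (i < k.+1)%N by rewrite ltnS.
rewrite (bigD1 (Ordinal ik1))//= /row_tail ik opsi eqxx mulr1 big1 ?addr0// => l li.
by rewrite -ltnS ltn_ord opsi eq_sym [_ == i](negbTE li) mulr0.
Qed.

End Factorization.

Theorem theorem5 (R : realType) (mu : probability (borel_circle R) R)
    (mu_infinite : infinite_set (msupport mu))
    (phi : nat -> {poly R[i]}) (phi_szego : orthonormal_szego mu phi)
    (alpha : nat -> R[i]) (alpha_schur : schur_parameters phi alpha)
    (p : nat -> nat) (p_gen : generating_sequence p)
    (psi : nat -> laurent R) (psi_on : orthonormal_laurent mu p psi) :
  forall n : nat, (1 <= n)%N ->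
    principal_submx n (snake p alpha n.-1) =
    principal_submx n (laurent_matrix mu psi).
Proof.
case=> // n _; apply/matrixP => i j; rewrite !mxE.
apply: (snake_laurent_matrix phi_szego alpha_schur p_gen psi_on);
  by rewrite -ltnS ltn_ord.
Qed.
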